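(* A quasigroup $Q$ belongs to the variety $\mathfrak{aD}_l$ (i.e. its left deviation $x\mapsto x\backslash x$ is an endomorphism of $Q$ whose image is a group) if and only if there exists a Bruck system $\mathcal{B}=\big(E,T,(\triangledown_{a,b})_{a,b\in E}\big)$ with $Q\cong Q(\mathcal{B})$ satisfying: (i) $E$ is a group (with unit element $1$); (ii) for every $a\in E$ the quasigroup $\mathcal{T}_{a,1}=(T,\triangledown_{a,1})$ has a right unit element, denoted by $\epsilon(a)$ (so $\alpha\,\triangledown_{a,1}\,\epsilon(a)=\alpha$ for all $\alpha\in T$); (iii) the map $\epsilon:E\to\mathcal{T}_{1,1}=(T,\triangledown_{1,1})$ is a homomorphism of the group $E$ into the quasigroup $\mathcal{T}_{1,1}$, which is identified with the normal subquasigroup $\pi^{-1}(1)=T\times\{1\}$ of $Q(\mathcal{B})$. In this case (that is, for any Bruck system $\mathcal{B}$ with $Q\cong Q(\mathcal{B})$ satisfying (i), (ii) and (iii)) the left deviation $e$ of $Q(\mathcal{B})$ satisfies $e(\alpha,a)=(\epsilon(a),1)$ for all $(\alpha,a)\in T\times E$.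
   Context: A quasigroup is a set $Q$ with a binary multiplication such that for all $a,b\in Q$ the equations $a\cdot y=b$ and $x\cdot a=b$ have exactly one solution each, denoted $y=a\backslash b$ and $x=b/a$. The left deviation of a quasigroup $Q$ is the map $e:Q\to Q$, $e(x)=x\backslash x$. $\mathfrak{D}_l$ is the variety of all quasigroups whose left deviation is an endomorphism, and $\mathfrak{aD}_l$ is the subvariety of those $Q\in\mathfrak{D}_l$ for which the image $e(Q)$ is a group. A right unit element of a quasigroup $(T,\triangledown)$ is an element $\epsilon\in T$ with $\alpha\,\triangledown\,\epsilon=\alpha$ for all $\alpha\in T$. A Bruck system $\mathcal{B}=\big(E,T,(\triangledown_{a,b})_{a,b\in E}\big)$ consists of a quasigroup $E$, a set $T$, and a family of multiplications $\triangledown_{a,b}$ on $T$ ($a,b\in E$) such that each $\mathcal{T}_{a,b}=(T,\triangledown_{a,b})$ is a quasigroup. $Q(\mathcal{B})$ denotes the quasigroup on the set $T\times E$ with multiplication $(\alpha,a)\circ(\beta,b)=(\alpha\,\triangledown_{a,b}\,\beta,\,ab)$. The projection $\pi:Q(\mathcal{B})\to E$, $\pi(\alpha,a)=a$, is an epimorphism of quasigroups, called the canonical epimorphism. When $E$ is a group with unit $1$, the fibre $\pi^{-1}(1)=T\times\{1\}$ is a subquasigroup of $Q(\mathcal{B})$ (normal in the sense of being a class of the congruence defined by $\pi$), identified with $\mathcal{T}_{1,1}$ via $(\alpha,1)\leftrightarrow\alpha$. *)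

(* Defs.v *)
From mathcomp Require Import ssreflect ssrfun ssrbool.

Set Implicit Arguments.
Unset Strict Implicit.
Unset Printing Implicit Defensive.

Declare Scope quasigroup_scope.
Open Scope quasigroup_scope.

(* A quasigroup multiplication on [T]. The two equivalences say that
   [a * y = b] and [x * a = b] have exactly one solution each, and that these
   solutions are the quotients [ldiv a b] (written a \ b) and [rdiv b a]
   (written b / a). The set [T] may be empty. *)
Record quasigroup_law (T : Type) := QuasigroupLaw {
  law_mul :> T -> T -> T;
  law_ldiv : T -> T -> T;
  law_rdiv : T -> T -> T;
  law_ldivP : forall a b y, law_mul a y = b <-> y = law_ldiv a b;
  law_rdivP : forall a b x, law_mul x a = b <-> x = law_rdiv b a
}.

Record quasigroup := Quasigroup {
  qsort :> Type;
  qlaw : quasigroup_law qsort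
}.

Definition qmul (Q : quasigroup) : Q -> Q -> Q := law_mul (qlaw Q).
Definition qldiv (Q : quasigroup) : Q -> Q -> Q := law_ldiv (qlaw Q).
Definition qrdiv (Q : quasigroup) : Q -> Q -> Q := law_rdiv (qlaw Q).

Notation "x ∘ y" := (qmul x y)
  (at level 40, left associativity) : quasigroup_scope.

Definition quasigroup_hom (P Q : quasigroup) (f : P -> Q) : Prop :=
  {morph f : x y / x ∘ y >-> x ∘ y}.

Definition quasigroup_isomorphic (P Q : quasigroup) : Prop :=
  exists f : P -> Q, bijective f /\ quasigroup_hom f.

(* The subset [A] of [Q], with the multiplication of [Q] restricted to it, is a
   group with unit element [one]. *)
Definition group_on (Q : quasigroup) (A : Q -> Prop) (one : Q) : Prop :=
  [/\ forall x y, A x -> A y -> A (x ∘ y),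
      forall x y z, A x -> A y -> A z -> x ∘ (y ∘ z) = (x ∘ y) ∘ z,
      A one,
      forall x, A x -> one ∘ x = x /\ x ∘ one = x
    & forall x, A x -> exists y, [/\ A y, y ∘ x = one & x ∘ y = one]].

Definition group_with_unit (E : quasigroup) (one : E) : Prop :=
  group_on (fun _ => True) one.

Definition left_deviation (Q : quasigroup) (x : Q) : Q := qldiv x x.

Definition image (P Q : Type) (f : P -> Q) : Q -> Prop :=
  fun y => exists x, y = f x.

Definition in_Dl (Q : quasigroup) : Prop :=
  quasigroup_hom (@left_deviation Q).

Definition in_aDl (Q : quasigroup) : Prop :=
  in_Dl Q /\ exists one : Q, group_on (image (@left_deviation Q)) one.

Record bruck_system := BruckSystem {
  bruck_base : quasigroup;
  bruck_set : Type;
  bruck_law : bruck_base -> bruck_base -> quasigroup_law bruck_set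
}.

(* The quasigroup T_{a,b}. *)
Definition bruck_component (B : bruck_system) (a b : bruck_base B) :
    quasigroup :=
  Quasigroup (bruck_law a b).

Section BruckQuasigroup.
Variable B : bruck_system.
Let E := bruck_base B.
Let T := bruck_set B.

Definition bruck_mul (x y : T * E) : T * E :=
  (bruck_law x.2 y.2 x.1 y.1, x.2 ∘ y.2).

Definition bruck_ldiv (x z : T * E) : T * E :=
  let b := qldiv x.2 z.2 in (law_ldiv (bruck_law x.2 b) x.1 z.1, b).

Definition bruck_rdiv (z y : T * E) : T * E :=
  let a := qrdiv z.2 y.2 in (law_rdiv (bruck_law a y.2) z.1 y.1, a).

Lemma bruck_ldivP x z y : bruck_mul x y = z <-> y = bruck_ldiv x z.
Proof.
case: x z y => [α a] [γ c] [β b]; rewrite /bruck_mul /bruck_ldiv /=; split.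
- move=> [h /law_ldivP]; rewrite -/(qldiv a c) => <-.
  by congr (_, _); apply/law_ldivP.
- move=> [hβ hb]; rewrite hβ -hb.
  by congr (_, _); [apply/law_ldivP | apply/law_ldivP].
Qed.

Lemma bruck_rdivP y z x : bruck_mul x y = z <-> x = bruck_rdiv z y.
Proof.
case: x z y => [α a] [γ c] [β b]; rewrite /bruck_mul /bruck_rdiv /=; split.
- move=> [h /law_rdivP]; rewrite -/(qrdiv c b) => <-.
  by congr (_, _); apply/law_rdivP.
- move=> [hα ha]; rewrite hα -ha.
  by congr (_, _); [apply/law_rdivP | apply/law_rdivP].
Qed.

Definition bruck_quasigroup : quasigroup :=
  Quasigroup (QuasigroupLaw bruck_ldivP bruck_rdivP).

Definition canonical_epi (x : bruck_quasigroup) : E := x.2.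

Lemma canonical_epi_hom : quasigroup_hom canonical_epi.
Proof. by []. Qed.

(* The identification of T_{1,1} with the fibre of the canonical epimorphism
   over the unit element. *)
Definition fibre_embedding (one : E) (α : bruck_component one one) :
    bruck_quasigroup :=
  (α, one).

Lemma fibre_embeddingP (one : E) : group_with_unit one ->
  [/\ quasigroup_hom (@fibre_embedding one),
      injective (@fibre_embedding one)
    & forall x : bruck_quasigroup,
        canonical_epi x = one <-> image (@fibre_embedding one) x].
Proof.
move=> [_ _ _ one_id _]; split.
- move=> α β; rewrite /fibre_embedding /qmul /= /bruck_mul /=.
  by rewrite (one_id one I).1.
- by move=> α β [].
- move=> [α a]; split=> [<-|[β [_ ->]]//]; by exists α.
Qed.

End BruckQuasigroup.

Definition is_right_unit (Q : quasigroup) (ε : Q) : Prop :=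
  forall α : Q, α ∘ ε = α.

(* Conditions (i)-(iii), with [one] the unit element of the base and [ε a] the
   right unit element of T_{a,1}; the latter is unique because T_{a,1} is a
   quasigroup. All T_{a,b} have the same carrier, so that [ε] is also a map into
   T_{1,1}. *)
Definition bruck_conditions (B : bruck_system) (one : bruck_base B)
    (ε : bruck_base B -> bruck_set B) : Prop :=
  [/\ group_with_unit one,
      forall a : bruck_base B, @is_right_unit (bruck_component a one) (ε a)
    & @quasigroup_hom (bruck_base B) (bruck_component one one) ε].

(* Main.v *)
Require Import Defs.
From mathcomp Require Import ssreflect ssrfun ssrbool.
From Stdlib Require Import ProofIrrelevance IndefiniteDescription.

Set Implicit Arguments.
Unset Strict Implicit.
Unset Printing Implicit Defensive.

(** Both sides of the equivalence say that the left deviation e of Q factors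
    through a group E as

      Q --p--> E --j--> Q,

    with p a surjective homomorphism and j a homomorphism
    ([deviation_factorisation]).

    If e is an endomorphism whose image is a group, take E := e(Q), let p be e
    itself and j the inclusion ([in_aDl_factorisation]).  Conversely, such a
    factorisation makes e an endomorphism with image j(E), which is a group as
    the homomorphic image of one ([factorisation_in_aDl]).

    A Bruck system with Q ≅ Q(B) and (i)-(iii) gives a factorisation with p the
    canonical epimorphism and j a = (ε a, 1): being a right unit means exactly
    that (α, a) ∘ (ε a, 1) = (α, a), which is the formula for e
    ([bruck_left_deviation], [bruck_factorisation]).  For the other direction,
    the fibres of p are all in bijection with the fibre over 1, by right
    translations by chosen representatives, so Q may be identified with the
    product of that fibre T and E; the multiplication of Q then becomes that of
    a Bruck system ([chart_bruck]).  Since x = x ∘ j (p x) for all x, and j (p x)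
    lies over 1 ([factorisation_fibre]), the T-coordinate of j a is a right unit
    of T_{a,1}, whichever bijections were chosen ([factorisation_bruck]). *)

(** * Quasigroups and homomorphisms *)

Section QuasigroupTheory.
Variable Q : quasigroup.

Lemma qldivP (a b y : Q) : a ∘ y = b <-> y = qldiv a b.
Proof. exact: law_ldivP. Qed.

Lemma qrdivP (a b x : Q) : x ∘ a = b <-> x = qrdiv b a.
Proof. exact: law_rdivP. Qed.

Lemma qldivKV (a b : Q) : a ∘ qldiv a b = b.
Proof. exact/qldivP. Qed.

Lemma qrdivKV (a b : Q) : qrdiv b a ∘ a = b.
Proof. exact/qrdivP. Qed.

Lemma qrdivK (a x : Q) : qrdiv (x ∘ a) a = x.
Proof. by symmetry; apply/qrdivP. Qed.

Lemma left_deviationP (x y : Q) : x ∘ y = x <-> left_deviation x = y.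
Proof. by split=> [/qldivP|<-]; [|exact: qldivKV]. Qed.

Lemma group_on_ext (A B : Q -> Prop) (one : Q) :
  (forall x, A x <-> B x) -> group_on A one -> group_on B one.
Proof.
move=> AB [mulA assA oneA idA invA]; split.
- by move=> x y /AB Ax /AB Ay; apply/AB/mulA.
- by move=> x y z /AB Ax /AB Ay /AB Az; apply: assA.
- exact/AB.
- by move=> x /AB; apply: idA.
- by move=> x /AB/invA [y [Ay yx xy]]; exists y; split=> //; apply/AB.
Qed.

End QuasigroupTheory.

Section HomTheory.
Variables (P Q : quasigroup) (f : P -> Q).
Hypothesis fM : quasigroup_hom f.

Lemma hom_qldiv (x y : P) : f (qldiv x y) = qldiv (f x) (f y).
Proof. by apply/qldivP; rewrite -fM qldivKV. Qed.

Lemma hom_qrdiv (x y : P) : f (qrdiv x y) = qrdiv (f x) (f y).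
Proof. by apply/qrdivP; rewrite -fM qrdivKV. Qed.

Lemma hom_inverse (g : Q -> P) :
  cancel f g -> cancel g f -> quasigroup_hom g.
Proof. by move=> fK gK x y; rewrite -{1}(gK x) -{1}(gK y) -fM fK. Qed.

Lemma hom_image_group (one : P) :
  group_with_unit one -> group_on (image f) (f one).
Proof.
move=> [_ assP _ idP invP]; split.
- by move=> _ _ [x ->] [y ->]; exists (x ∘ y); rewrite fM.
- by move=> _ _ _ [x ->] [y ->] [z ->]; rewrite -!fM assP.
- by exists one.
- by move=> _ [x ->]; rewrite -!fM; have [-> ->] := idP x I.
- move=> _ [x ->]; have [y [_ yx xy]] := invP x I.
  by exists (f y); split; [exists y | rewrite -fM yx | rewrite -fM xy].
Qed.

End HomTheory.

(** * The image of a homomorphism as a quasigroup *)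

Section HomImage.
Variables (P Q : quasigroup) (f : P -> Q).
Hypothesis fM : quasigroup_hom f.

Definition hom_image : Type := {y : Q | image f y}.

Lemma hom_image_inj (u v : hom_image) : sval u = sval v -> u = v.
Proof. by case: u v => [x Ix] [y Iy] /=; apply: subset_eq_compat. Qed.

Definition to_hom_image (x : P) : hom_image :=
  exist _ (f x) (ex_intro _ x erefl).

Lemma to_hom_image_surj (u : hom_image) : exists x, to_hom_image x = u.
Proof. by case: u => y [x y_fx]; exists x; apply: hom_image_inj. Qed.

Lemma hom_image_mul_subproof (u v : hom_image) : image f (sval u ∘ sval v).
Proof.
case: u v => [u Iu] [v Iv] /=; have [[x ->] [y ->]] := (Iu, Iv).
by exists (x ∘ y); rewrite fM.
Qed.

Lemma hom_image_ldiv_subproof (u v : hom_image) :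
  image f (qldiv (sval u) (sval v)).
Proof.
case: u v => [u Iu] [v Iv] /=; have [[x ->] [y ->]] := (Iu, Iv).
by exists (qldiv x y); rewrite hom_qldiv.
Qed.

Lemma hom_image_rdiv_subproof (u v : hom_image) :
  image f (qrdiv (sval u) (sval v)).
Proof.
case: u v => [u Iu] [v Iv] /=; have [[x ->] [y ->]] := (Iu, Iv).
by exists (qrdiv x y); rewrite hom_qrdiv.
Qed.

Definition hom_image_mul u v : hom_image :=
  exist _ _ (hom_image_mul_subproof u v).
Definition hom_image_ldiv u v : hom_image :=
  exist _ _ (hom_image_ldiv_subproof u v).
Definition hom_image_rdiv u v : hom_image :=
  exist _ _ (hom_image_rdiv_subproof u v).

Lemma hom_image_ldivP u v w :
  hom_image_mul u w = v <-> w = hom_image_ldiv u v.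
Proof.
split=> [<-|->]; apply: hom_image_inj => /=; last exact: qldivKV.
exact/qldivP.
Qed.

Lemma hom_image_rdivP u v w :
  hom_image_mul w u = v <-> w = hom_image_rdiv v u.
Proof.
by split=> [<-|->]; apply: hom_image_inj => /=; rewrite (qrdivK, qrdivKV).
Qed.

Definition image_quasigroup : quasigroup :=
  Quasigroup (QuasigroupLaw hom_image_ldivP hom_image_rdivP).

Lemma image_quasigroup_group (one : image_quasigroup) :
  group_on (image f) (sval one) -> group_with_unit one.
Proof.
move=> [_ assI _ idI invI]; split=> //.
- by move=> [x Ix] [y Iy] [z Iz] _ _ _; apply: hom_image_inj; apply: assI.
- move=> [x Ix] _; have [e1x ex1] := idI x Ix.
  by split; apply: hom_image_inj.
- move=> [x Ix] _; have [y [Iy yx xy]] := invI x Ix.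
  by exists (exist _ y Iy); split=> //; apply: hom_image_inj.
Qed.

End HomImage.

(** * Factorisations of the left deviation through a group *)

(** E stands for any group, possibly larger than the image of the left
    deviation, because the base of a Bruck system can be larger: when Q is a
    group, T may be a point and E = Q, with ε and [j] trivial. *)
Definition deviation_factorisation (Q E : quasigroup) (one : E)
    (p : Q -> E) (j : E -> Q) : Prop :=
  [/\ group_with_unit one,
      quasigroup_hom p /\ forall a, exists x, p x = a,
      quasigroup_hom j
    & forall x, left_deviation x = j (p x)].

(** Applying [p] to x ∘ j (p x) = x and cancelling [p x] in the group E. *)
Lemma factorisation_fibre (Q E : quasigroup) (one : E) p j :
  @deviation_factorisation Q E one p j -> forall a, p (j a) = one.
Proof.
move=> [[_ _ _ idE _] [pM p_surj] _ ejp] a; have [x <-] := p_surj a.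
have /qldivP -> : p x ∘ p (j (p x)) = p x.
  by rewrite -pM; congr p; apply/left_deviationP.
by symmetry; apply/qldivP; have [] := idE (p x) I.
Qed.

Lemma factorisation_in_aDl (Q E : quasigroup) (one : E) p j :
  @deviation_factorisation Q E one p j -> in_aDl Q.
Proof.
move=> [gE [pM p_surj] jM ejp]; split.
- by move=> x y; rewrite !ejp pM jM.
- exists (j one); apply: (group_on_ext _ (hom_image_group jM gE)) => y; split.
  + by move=> [a ->]; have [x <-] := p_surj a; exists x; rewrite ejp.
  + by move=> [x ->]; exists (p x); rewrite ejp.
Qed.

Lemma in_aDl_factorisation (Q : quasigroup) :
  in_aDl Q -> exists E one p j, @deviation_factorisation Q E one p j.
Proof.
move=> [eM [one gI]]; have [_ _ Ione _ _] := gI.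
exists (image_quasigroup eM), (exist _ one Ione).
exists (to_hom_image (@left_deviation Q)), (fun a => sval a).
split=> //.
- exact: image_quasigroup_group.
- split; last exact: to_hom_image_surj.
  by move=> x y; apply: hom_image_inj; apply: eM.
Qed.

(** * From Bruck systems to factorisations *)

Lemma bruck_left_deviation (B : bruck_system) (one : bruck_base B)
    (ε : bruck_base B -> bruck_set B) :
  bruck_conditions one ε ->
  forall (α : bruck_set B) (a : bruck_base B),
    @left_deviation (bruck_quasigroup B) (α, a) = (ε a, one).
Proof.
move=> [[_ _ _ idE _] unitε _] α a; apply/left_deviationP.
congr (_, _); first exact: unitε.
by have [] := idE a I.
Qed.

Lemma bruck_factorisation (Q : quasigroup) (B : bruck_system)
    (one : bruck_base B) (ε : bruck_base B -> bruck_set B) :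
  quasigroup_isomorphic Q (bruck_quasigroup B) -> bruck_conditions one ε ->
  exists p j, @deviation_factorisation Q (bruck_base B) one p j.
Proof.
move=> [f [[g fK gK] fM]] cB; have [gE _ εM] := cB.
have [_ _ _ idE _] := gE.
have gM := hom_inverse fM fK gK.
exists (fun x => canonical_epi (f x)), (fun a => g (ε a, one)).
split=> //.
- split=> [x y|a]; first by rewrite fM canonical_epi_hom.
  (* ε a shows that the carrier set, hence the fibre over a, is inhabited. *)
  by exists (g (ε a, a)); rewrite gK.
- move=> a b; rewrite -gM; congr g; congr (_, _); first exact: εM.
  by have [-> _] := idE one I.
- move=> x; apply: (can_inj fK); rewrite gK.
  rewrite [LHS](hom_qldiv fM) -/(left_deviation (f x)).
  by rewrite [f x]surjective_pairing (bruck_left_deviation cB).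
Qed.

(** * From factorisations to Bruck systems *)

(** A bijection of [Q] with [T * E] over [E] turns the multiplication of [Q]
    into that of a Bruck system: the law T_{a,b} is the product of the fibres
    over [a] and [b], read in the coordinates of the fibre over [a ∘ b]. *)
Section Chart.
Variables (Q E : quasigroup) (p : Q -> E) (T : Type).
Variables (enc : Q -> T) (dec : T -> E -> Q).
Hypothesis pM : quasigroup_hom p.
Hypothesis p_dec : forall t a, p (dec t a) = a.
Hypothesis enc_dec : forall t a, enc (dec t a) = t.
Hypothesis dec_enc : forall x, dec (enc x) (p x) = x.

Lemma dec_encE x a : p x = a -> dec (enc x) a = x.
Proof. by move=> <-. Qed.

Definition chart_mul (a b : E) (t u : T) : T := enc (dec t a ∘ dec u b).
Definition chart_ldiv (a b : E) (t v : T) : T :=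
  enc (qldiv (dec t a) (dec v (a ∘ b))).
Definition chart_rdiv (a b : E) (v u : T) : T :=
  enc (qrdiv (dec v (a ∘ b)) (dec u b)).

Lemma chart_ldivP a b t v u : chart_mul a b t u = v <-> u = chart_ldiv a b t v.
Proof.
rewrite /chart_mul /chart_ldiv; split=> [<-|->].
- rewrite dec_encE; last by rewrite pM !p_dec.
  have /qldivP <- : dec t a ∘ dec u b = dec t a ∘ dec u b by [].
  by rewrite enc_dec.
- rewrite dec_encE; first by rewrite qldivKV enc_dec.
  rewrite (hom_qldiv pM) !p_dec.
  by symmetry; apply/qldivP.
Qed.

Lemma chart_rdivP a b u v t : chart_mul a b t u = v <-> t = chart_rdiv a b v u.
Proof.
rewrite /chart_mul /chart_rdiv; split=> [<-|->].
- rewrite dec_encE; last by rewrite pM !p_dec.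
  by rewrite qrdivK enc_dec.
- rewrite dec_encE; first by rewrite qrdivKV enc_dec.
  by rewrite (hom_qrdiv pM) !p_dec qrdivK.
Qed.

Definition chart_bruck : bruck_system :=
  BruckSystem (fun a b => QuasigroupLaw (@chart_ldivP a b) (@chart_rdivP a b)).

Lemma chart_bruck_iso : quasigroup_isomorphic Q (bruck_quasigroup chart_bruck).
Proof.
exists (fun x => (enc x, p x)); split.
- exists (fun y => dec y.1 y.2) => [x|[t a]] /=; first exact: dec_enc.
  by rewrite enc_dec p_dec.
- move=> x y; rewrite /qmul /= /bruck_mul /= /chart_mul !dec_enc.
  by congr (_, _); apply: pM.
Qed.

Lemma chart_bruck_conditions (one : E) (j : E -> Q) :
  deviation_factorisation one p j ->
  @bruck_conditions chart_bruck one (fun a => enc (j a)).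
Proof.
move=> fac; have [gE _ jM ejp] := fac.
have pj := factorisation_fibre fac; split=> //.
- move=> a t.
  rewrite /qmul /= /chart_mul (dec_encE (pj a)).
  (* dec t a lies over a, so its left deviation is j a. *)
  have /left_deviationP -> : left_deviation (dec t a) = j a.
    by rewrite ejp p_dec.
  exact: enc_dec.
- by move=> a b; rewrite jM /qmul /= /chart_mul !(dec_encE (pj _)).
Qed.

End Chart.

(** With a section [s] of [p], the right translation [t |-> t ∘ s a] is a
    bijection of the fibre over the unit with the fibre over [a], because the
    unit is a left unit of E. *)
Lemma fibre_chart (Q E : quasigroup) (one : E) (p : Q -> E) :
  quasigroup_hom p -> (forall a, exists x, p x = a) ->
  (forall a, one ∘ a = a) ->
  exists (T : Type) (enc : Q -> T) (dec : T -> E -> Q),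
    [/\ forall t a, p (dec t a) = a,
        forall t a, enc (dec t a) = t
      & forall x, dec (enc x) (p x) = x].
Proof.
move=> pM p_surj one_id.
have [s sK] := functional_choice _ p_surj.
have encP x : p (qrdiv x (s (p x))) = one.
  rewrite (hom_qrdiv pM) sK; symmetry; exact/qrdivP.
have decP (t : {x | p x = one}) a : p (sval t ∘ s a) = a.
  by rewrite pM (svalP t) sK.
exists {x | p x = one}, (fun x => exist (fun y => p y = one) _ (encP x)).
exists (fun t a => sval t ∘ s a).
split=> [//|t a|x]; last exact: qrdivKV.
case: t => t pt; apply: subset_eq_compat => /=.
by rewrite (decP (exist (fun y => p y = one) t pt)) qrdivK.
Qed.

Lemma factorisation_bruck (Q E : quasigroup) (one : E) p j :
  @deviation_factorisation Q E one p j ->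
  exists (B : bruck_system) (one : bruck_base B)
         (ε : bruck_base B -> bruck_set B),
    quasigroup_isomorphic Q (bruck_quasigroup B) /\ bruck_conditions one ε.
Proof.
move=> fac; have [[_ _ _ idE _] [pM p_surj] _ _] := fac.
have one_id a : one ∘ a = a by have [] := idE a I.
have [T [enc [dec [p_dec enc_dec dec_enc]]]] := fibre_chart pM p_surj one_id.
exists (chart_bruck pM p_dec enc_dec dec_enc), one, (fun a => enc (j a)).
by split; [exact: chart_bruck_iso | exact: chart_bruck_conditions].
Qed.

(** * The characterisation *)

Theorem theorem5 (Q : quasigroup) :
  (in_aDl Q <->
   exists (B : bruck_system) (one : bruck_base B)
          (ε : bruck_base B -> bruck_set B),
     quasigroup_isomorphic Q (bruck_quasigroup B) /\
     bruck_conditions one ε) /\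
  (forall (B : bruck_system) (one : bruck_base B)
          (ε : bruck_base B -> bruck_set B),
     quasigroup_isomorphic Q (bruck_quasigroup B) ->
     bruck_conditions one ε ->
     forall (α : bruck_set B) (a : bruck_base B),
       @left_deviation (bruck_quasigroup B) (α, a) = (ε a, one)).
Proof.
split; last by move=> B one ε _; apply: bruck_left_deviation.
split=> [/in_aDl_factorisation [E [one [p [j fac]]]]|].
- exact: factorisation_bruck fac.
- move=> [B [one [ε [isoQ cB]]]].
  have [p [j fac]] := bruck_factorisation isoQ cB.
  exact: factorisation_in_aDl fac.
Qed.
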